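(* Let $n\ge2$ and let $\mathcal{D}_1,\dots,\mathcal{D}_k\subseteq\binom{[n]}{2}$ be the dependent sets of $k\geq 1$ positroids (i.e. each $(\mathcal{D}_i)^c$ is a positroid), and put $\mathcal{D}=\mathcal{D}_1\cup\dots\cup\mathcal{D}_k$. The set of the maximal positroids lying in the common boundary of the positroid cells associated to $(\mathcal{D}_1)^c,\dots,(\mathcal{D}_k)^c$ is equal to $$\mathrm{MPos}(\mathcal{D})=\mathrm{Mat}(\mathcal{D})=\left\{\left(\overline{\mathcal{D}+T}\right)^c : T\in\mathbb{T}_{\mathcal{D}},\ \left(\overline{\mathcal{D}+T}\right)^c\ne\emptyset\right\}.$$
   Context: $[n]=\{1,\dots,n\}$ is cyclically ordered, $\binom{[n]}{2}$ is the set of 2-element subsets of $[n]$, and complements $(\cdot)^c$ are taken in $\binom{[n]}{2}$. A matroid here is a nonempty collection $\mathcal{B}\subseteq\binom{[n]}{2}$ (the bases) satisfying: for all $B_1,B_2\in\mathcal{B}$ and $b_1\in B_1\setminus B_2$ there is $b_2\in B_2\setminus B_1$ with $(B_1\setminus\{b_1\})\cup\{b_2\}\in\mathcal{B}$. A positroid here is a nonempty collection $\mathcal{I}\subseteq\binom{[n]}{2}$ for which there is a real $2\times n$ matrix $A$ such that, for $I=\{i<j\}$, the minor $\det A[I]$ on columns $i,j$ (in this order) is $>0$ if $I\in\mathcal{I}$ and $=0$ otherwise. A positroid $\mathcal{P}$ is said to lie in the common boundary of the cells of $(\mathcal{D}_1)^c,\dots,(\mathcal{D}_k)^c$ (i.e.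 in the intersection of their closures) if $\mathcal{P}\subseteq(\mathcal{D}_i)^c$ for all $i$, equivalently $\mathcal{P}\subseteq\mathcal{D}^c$. $\mathrm{Mat}(\mathcal{D})$ (resp. $\mathrm{MPos}(\mathcal{D})$) is the set of inclusion-maximal elements among the matroids (resp. positroids) contained in $\mathcal{D}^c$. Put $T_{\mathcal{D}}=\{i\in[n] : \{i,j\}\in\mathcal{D}\text{ for all }j\in[n]\setminus\{i\}\}$, and let $G_{\mathcal{D}}$ be the simple graph with vertex set $[n]\setminus T_{\mathcal{D}}$ and edge set $\{\{i,j\}\in\mathcal{D} : i,j\notin T_{\mathcal{D}}\}$. For $T\subseteq[n]\setminus T_{\mathcal{D}}$ let - $\mathcal{D}+T=\mathcal{D}\cup\{\{i,j\} : i\in T,\ j\in[n]\setminus\{i\}\}$; - $G_{\mathcal{D}}\setminus T$ be the induced subgraph of $G_{\mathcal{D}}$ on $[n]\setminus(T_{\mathcal{D}}\cup T)$; - $c(\mathcal{D}+T)$ be the number of connected components of $G_{\mathcal{D}}\setminus T$ (isolated vertices count as components); - $\overline{\mathcal{D}+T}$ be the union of $\mathcal{D}+T$ with the set of all pairs $\{i,k\}$ of distinct vertices lying in the same connected component of $G_{\mathcal{D}}\setminus T$. Finally $$\mathbb{T}_{\mathcal{D}}=\{T\subseteq[n]\setminus T_{\mathcal{D}} : T=\emptyset\ \text{ or }\ c(\mathcal{D}+T)>c(\mathcal{D}+(T\setminus\{i\}))\text{ for every } i\in T\}.$$ *)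

(* Defs.v *)
From HB Require Import structures.
From mathcomp Require Import all_boot all_order all_algebra.
From mathcomp Require Import classical_sets reals.
(* Imported again so that set0 and the like denote the finite-set versions. *)
Import mathcomp.boot.finset.

Set Implicit Arguments.
Unset Strict Implicit.
Unset Printing Implicit Defensive.

Import GRing.Theory Num.Theory.
Local Open Scope ring_scope.

(* The ground set [n] = {1, ..., n} is represented by 'I_n = {0, ..., n - 1}. *)

Definition pairs (n : nat) : {set {set 'I_n}} :=
  [set S : {set 'I_n} | #|S| == 2%N].

Definition pcompl (n : nat) (D : {set {set 'I_n}}) : {set {set 'I_n}} :=
  pairs n :\: D.

Definition matroid (n : nat) (B : {set {set 'I_n}}) : Prop :=
  [/\ B \subset pairs n,
      B != set0 &
      forall (B1 B2 : {set 'I_n}) (b1 : 'I_n),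
        B1 \in B -> B2 \in B -> b1 \in B1 :\: B2 ->
        exists2 b2 : 'I_n, b2 \in B2 :\: B1 & b2 |: (B1 :\ b1) \in B].

Definition minor2 (R : realType) (n : nat) (A : 'M[R]_(2, n)) (i j : 'I_n) : R :=
  \det (colsub (tnth [tuple i; j]) A).

Definition positroid (R : realType) (n : nat) (I : {set {set 'I_n}}) : Prop :=
  [/\ I \subset pairs n,
      I != set0 &
      exists A : 'M[R]_(2, n), forall i j : 'I_n, (i < j)%N ->
        if [set i; j] \in I then 0 < minor2 A i j else minor2 A i j == 0].

Definition inclusion_maximal (T : finType) (P : {set T} -> Prop) : set {set T} :=
  [set A | P A /\ forall B : {set T}, P B -> A \subset B -> B = A]%classic.

Definition Mat (n : nat) (D : {set {set 'I_n}}) : set {set {set 'I_n}} :=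
  inclusion_maximal (fun B => matroid B /\ B \subset pcompl D).

Definition MPos (R : realType) (n : nat) (D : {set {set 'I_n}}) :
    set {set {set 'I_n}} :=
  inclusion_maximal (fun P => positroid R P /\ P \subset pcompl D).

(* P lies in the intersection of the closures of the cells of (D i)^c, i < k. *)
Definition in_common_boundary (n k : nat) (D : 'I_k -> {set {set 'I_n}})
    (P : {set {set 'I_n}}) : Prop :=
  forall i : 'I_k, P \subset pcompl (D i).

Definition max_boundary_positroids (R : realType) (n k : nat)
    (D : 'I_k -> {set {set 'I_n}}) : set {set {set 'I_n}} :=
  inclusion_maximal (fun P => positroid R P /\ in_common_boundary D P).

Definition Tloops (n : nat) (D : {set {set 'I_n}}) : {set 'I_n} :=
  [set i | [forall j, (j != i) ==> ([set i; j] \in D)]].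

Definition Gvertices (n : nat) (D : {set {set 'I_n}}) (T : {set 'I_n}) :
    {set 'I_n} := ~: (Tloops D :|: T).

(* Adjacency in G_D \ T, as a relation on all of 'I_n under which the points
   outside Gvertices T are isolated. *)
Definition Gedge (n : nat) (D : {set {set 'I_n}}) (T : {set 'I_n}) : rel 'I_n :=
  [rel i j | [&& i \in Gvertices D T, j \in Gvertices D T, i != j
               & [set i; j] \in D]].

Definition Dplus (n : nat) (D : {set {set 'I_n}}) (T : {set 'I_n}) :
    {set {set 'I_n}} :=
  D :|: [set [set i; j] | i in T, j in [set~ i]].

Definition ncomp (n : nat) (D : {set {set 'I_n}}) (T : {set 'I_n}) : nat :=
  n_comp (Gedge D T) (Gvertices D T).

Definition Dplus_closure (n : nat) (D : {set {set 'I_n}}) (T : {set 'I_n}) :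
    {set {set 'I_n}} :=
  Dplus D T :|:
  [set [set i; k] | i in Gvertices D T,
                    k in [set k in Gvertices D T | (k != i) && connect (Gedge D T) i k]].

Definition TT (n : nat) (D : {set {set 'I_n}}) : {set {set 'I_n}} :=
  [set T : {set 'I_n} | (T \subset ~: Tloops D) &&
     ((T == set0) || [forall i in T, (ncomp D (T :\ i) < ncomp D T)%N])].

Definition closure_bases (n : nat) (D : {set {set 'I_n}}) : set {set {set 'I_n}} :=
  [set B | exists T : {set 'I_n},
     [/\ T \in TT D, pcompl (Dplus_closure D T) != set0
       & B = pcompl (Dplus_closure D T)]]%classic.

(* Main.v *)
Require Import Defs.
From mathcomp Require Import all_boot all_order all_algebra.
From mathcomp Require Import boolp classical_sets reals ring.
Import mathcomp.boot.fintype mathcomp.boot.finset mathcomp.boot.fingraph.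

Set Implicit Arguments.
Unset Strict Implicit.
Unset Printing Implicit Defensive.

(* A rank-two matroid is a set of loops together with a partition of the other
   points into parallel classes; it is a positroid exactly when the classes are
   noncrossing, i.e. cyclic intervals of the set of non-loops. A matroid contained
   in the complement of D has the points of T_D as loops, and if T is the set of
   its other loops, its classes are unions of components of G_D \ T; so the
   maximal matroids are among those, B_T, whose classes are exactly these
   components, and B_T is maximal iff restoring any i in T as a non-loop would
   merge two components. When D is a union of dependent sets of positroids, every
   edge of G_D \ T comes from a cyclic-interval class, hence cannot jump over other
   non-loops without being joined to them: the components are noncrossing and all
   the B_T are positroids. *)

Import Order.TTheory GRing.Theory Num.Theory.

(** * Two-element sets and the rank-two exchange axiom *)

Lemma pairs2 n (i j : 'I_n) : ([set i; j] \in pairs n) = (i != j).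
Proof. by rewrite inE cards2; case: (i != j). Qed.

Lemma pairsP n (S : {set 'I_n}) :
  reflect (exists i j, i != j /\ S = [set i; j]) (S \in pairs n).
Proof.
rewrite inE; exact: cards2P.
Qed.

Lemma pairs_subsetP n (A B : {set {set 'I_n}}) : A \subset pairs n ->
  reflect (forall i j, [set i; j] \in A -> [set i; j] \in B) (A \subset B).
Proof.
move=> Apairs; apply: (iffP subsetP) => [AB i j|AB S SA]; first exact: AB.
have /pairsP[i [j [_ SE]]] := subsetP Apairs _ SA.
by move: SA; rewrite SE; apply: AB.
Qed.

Lemma pairs_neq0P n (B : {set {set 'I_n}}) : B \subset pairs n ->
  reflect (exists i j, [set i; j] \in B) (B != set0).
Proof.
move=> Bpairs; apply: (iffP (set0Pn _)) => [[S SB]|[i [j ijB]]]; last first.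
  by exists [set i; j].
have /pairsP[i [j [_ SE]]] := subsetP Bpairs _ SB.
by exists i, j; rewrite -SE.
Qed.

Lemma pcompl_pairs n (D : {set {set 'I_n}}) : pcompl D \subset pairs n.
Proof. exact: subsetDl. Qed.

Lemma mem2_pcompl n (D : {set {set 'I_n}}) (i j : 'I_n) :
  ([set i; j] \in pcompl D) = (i != j) && ([set i; j] \notin D).
Proof. by rewrite !inE cards2 andbC; case: (i != j). Qed.

(* The rank-two exchange axiom: a non-loop j (witnessed by l) cannot be
   parallel to both ends of a basis. *)
Lemma matroidP n (B : {set {set 'I_n}}) :
  matroid B <->
  [/\ B \subset pairs n, B != set0 &
      forall i j k l, [set i; k] \in B -> [set j; l] \in B ->
        ([set i; j] \in B) || ([set j; k] \in B)].
Proof.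
split=> -[Bpairs B0 exch]; split=> //.
  move=> i j k l ikB jlB.
  have [lik|lik] := boolP (l \in [set i; k]).
    case/set2P: lik jlB => -> jB; first by rewrite setUC jB.
    by rewrite jB orbT.
  have lD : l \in [set j; l] :\: [set i; k] by rewrite !inE eqxx orbT -in_set2 lik.
  have [b2] := exch _ _ _ jlB ikB lD.
  have jl : j != l by rewrite -pairs2 (subsetP Bpairs).
  have -> : [set j; l] :\ l = [set j].
    by rewrite setUC setU1K // inE eq_sym.
  by rewrite inE => /andP[_ /set2P[->|->]] b2B; rewrite ?b2B // [[set j; k]]setUC b2B orbT.
move=> B1 B2 b1 B1B B2B; rewrite inE => /andP[b1B2 b1B1].
have [x [b1x B1E]] : exists x, b1 != x /\ B1 = [set b1; x].
  have /pairsP[i [j [ij B1E]]] := subsetP Bpairs _ B1B.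
  move: b1B1; rewrite B1E => /set2P[->|->]; first by exists j.
  by exists i; rewrite eq_sym setUC.
have /pairsP[c [d [_ B2E]]] := subsetP Bpairs _ B2B.
have [y yB2 yxB] : exists2 y, y \in B2 & [set y; x] \in B.
  rewrite B2E in B2B *; rewrite B1E setUC in B1B.
  case/orP: (exch _ _ _ _ B2B B1B) => xB; first by exists c; rewrite ?set21.
  by exists d; rewrite ?set22 // setUC.
have yx : y != x by rewrite -pairs2 (subsetP Bpairs).
exists y; first by rewrite inE yB2 B1E !inE (negPf yx) orbF (memPn b1B2).
by rewrite B1E setU1K // inE.
Qed.

(** The support condition forced by the three-term Plücker relation with nonnegative minors. It is
    stronger than noncrossing of a partition in the usual sense: two parallel points may not be
    separated by [b] and [d] outside their class, even when [b] and [d] are not parallel to each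
    other. *)
Definition noncrossing n (B : {set {set 'I_n}}) : Prop :=
  forall a b c d : 'I_n, a < b -> b < c -> c < d ->
    ([set a; b] \in B) && ([set c; d] \in B) ||
    ([set a; d] \in B) && ([set b; c] \in B) ->
    ([set a; c] \in B) && ([set b; d] \in B).

(** * Rank-two positroids as noncrossing matroids *)

Section Realization.

Local Open Scope ring_scope.

Lemma minor2E (R : realType) n (A : 'M[R]_(2, n)) (i j : 'I_n) :
  minor2 A i j = A 0 i * A 1 j - A 0 j * A 1 i.
Proof.
rewrite /minor2 (expand_det_row _ 0) !big_ord_recl big_ord0 addr0 /cofactor.
rewrite !det_mx11 !mxE /=.
have -> : lift 0 0 = 1 :> 'I_2 by apply/val_inj.
have -> : lift 1 0 = 0 :> 'I_2 by apply/val_inj.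
by rewrite !(tnth_nth i) /= expr0 expr1 mul1r mulN1r mulrN.
Qed.

Lemma minor2_plucker (R : realType) n (A : 'M[R]_(2, n)) (i j k l : 'I_n) :
  minor2 A i k * minor2 A j l =
  minor2 A i j * minor2 A k l + minor2 A i l * minor2 A j k.
Proof. by rewrite !minor2E; ring. Qed.

(** Both claims are read off the Plücker relation: a vanishing right-hand side gives exchange, a
    positive one gives noncrossing. *)
Lemma positroid_noncrossing (R : realType) n (B : {set {set 'I_n}}) :
  positroid R B -> matroid B /\ noncrossing B.
Proof.
move=> [Bpairs B0 [A AB]].
(* Antisymmetry of the minors extends the hypothesis from [i < j] to all pairs of indices. *)
have mem i j : ([set i; j] \in B) = (minor2 A i j != 0).
  have lt_mem (u v : 'I_n) : (u < v)%N -> ([set u; v] \in B) = (minor2 A u v != 0).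
    by move/AB; case: ifP => _; [move/gt_eqF->|move->].
  have [ij|ji|/val_inj ->] := ltngtP i j; first exact: lt_mem.
    rewrite setUC lt_mem // -oppr_eq0; congr (_ != 0).
    by rewrite !minor2E; ring.
  rewrite minor2E subrr eqxx; apply: contraTF (eqxx j) => /(subsetP Bpairs).
  by rewrite pairs2.
have ge0 (i j : 'I_n) : (i < j)%N -> 0 <= minor2 A i j.
  by move/AB; case: ifP => _; [move/ltW|move/eqP->].
have gt0 (i j : 'I_n) : (i < j)%N -> [set i; j] \in B -> 0 < minor2 A i j.
  by move=> ij; rewrite mem lt_neqAle eq_sym => ->; exact: ge0.
split.
  apply/matroidP; split=> // i j k l; rewrite !mem => ik0 jl0.
  rewrite -negb_and; apply: contra ik0 => /andP[/eqP ij0 /eqP jk0].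
  have := minor2_plucker A i j k l; rewrite ij0 jk0 mul0r mulr0 addr0.
  by move/eqP; rewrite mulf_eq0 (negPf jl0) orbF.
move=> a b c d ab bc cd crossed.
have ac := ltn_trans ab bc; have bd := ltn_trans bc cd.
have ad := ltn_trans ab bd.
have : 0 < minor2 A a c * minor2 A b d.
  rewrite minor2_plucker; case/orP: crossed => /andP[? ?].
    by rewrite ltr_wpDr ?mulr_gt0 ?mulr_ge0 ?gt0 ?ge0.
  by rewrite ltr_wpDl ?mulr_gt0 ?mulr_ge0 ?gt0 ?ge0.
by move/lt0r_neq0; rewrite mulf_eq0 negb_or !mem.
Qed.

(* Non-loop i is sent to (1, m) with m the least element of its parallel class,
   negated when the class wraps around, i.e. when a non-loop outside the class
   separates i from a smaller element of the class. *)
Lemma noncrossing_positroid (R : realType) n (B : {set {set 'I_n}}) :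
  matroid B -> noncrossing B -> positroid R B.
Proof.
move=> /matroidP[Bpairs B0 exch] ncB; split=> //.
pose nl (i : 'I_n) := [exists j, [set i; j] \in B].
pose par (i : 'I_n) := [pred k : 'I_n | nl k && ([set k; i] \notin B)].
pose t (i : 'I_n) : 'I_n := [arg min_(k < i | par i k) k]%N.
pose wrap (i : 'I_n) :=
  [exists a : 'I_n, exists b : 'I_n, [&& (a < b)%N, (b < i)%N, par i a & [set b; i] \in B]].
have nlP i j : [set i; j] \in B -> nl i by move=> ijB; apply/existsP; exists j.
have nlP' i j : [set i; j] \in B -> nl j by rewrite setUC; apply: nlP.
have parT i k j : par i k -> [set i; j] \in B -> [set k; j] \in B.
  rewrite /= => /andP[/existsP[l klB] kiB] ijB.
  by have := exch _ _ _ _ ijB klB; rewrite setUC (negPf kiB).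
have par_refl i : nl i -> par i i.
  by rewrite /= => ->; apply/negP => /(subsetP Bpairs); rewrite pairs2 eqxx.
have par_sym i k : nl i -> par i k -> par k i.
  by rewrite /= => -> /andP[_]; rewrite setUC.
have tP i : nl i -> par i (t i) /\ forall k, par i k -> (t i <= k)%N.
  by move=> /par_refl nli; rewrite /t; case: arg_minnP.
have par_t i j : nl i -> nl j -> par i j -> t i = t j.
  move=> nli nlj ij; have [ti mi] := tP i nli; have [tj mj] := tP j nlj.
  have ji := par_sym _ _ nli ij.
  have tr u v w : nl u -> par u v -> par v w -> par u w.
    move=> nlu uv; rewrite /= => /andP[-> wv]; apply: contra wv => wu.
    by rewrite setUC; apply: parT uv _; rewrite setUC.
  apply/val_inj/eqP; rewrite /= eqn_leq mi ?mj //.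
    exact: tr ti.
  exact: tr tj.
pose s (i : 'I_n) : R := if nl i then (-1) ^+ wrap i else 0.
pose A : 'M[R]_(2, n) := \matrix_(r, i) (if r == 0 then s i else s i * (t i)%:R).
exists A => i j ij.
(* The minor vanishes at loops and inside a class; otherwise only the signs remain to be compared
   with the order of the two least elements. *)
have -> : minor2 A i j = s i * s j * ((t j)%:R - (t i)%:R).
  by rewrite minor2E !mxE /=; ring.
case: ifPn => [ijB|ijB]; last first.
  rewrite /s; case: (boolP (nl i)) => nli; last by rewrite !mul0r.
  case: (boolP (nl j)) => nlj; last by rewrite mulr0 mul0r.
  by rewrite (@par_t i j) ?subrr ?mulr0 //= nlj setUC.
have nli := nlP _ _ ijB; have nlj := nlP' _ _ ijB.
have [ti mi] := tP i nli; have [tj mj] := tP j nlj.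
have tij : [set t i; j] \in B by exact: parT ti ijB.
have titj : [set t i; t j] \in B.
  by rewrite setUC; apply: parT tj _; rewrite setUC.
(* If [i] wrapped around, [a < b < i < j] would have [a] and [i] parallel, separated by [b] and
   [j]. *)
have wi : wrap i = false.
  apply/negbTE/negP => /existsP[a /existsP[b /and4P[ab bi pa biB]]].
  have abB : [set a; b] \in B by apply: parT pa _; rewrite setUC.
  have := ncB _ _ _ _ ab bi ij; rewrite abB ijB => /(_ isT) /andP[aiB _].
  by case/andP: pa; rewrite aiB.
rewrite /s nli nlj wi mul1r.
have [tlt|tgt|/val_inj tE] := ltngtP (t i) (t j).
- have -> : wrap j = false.
    apply/negbTE/negP => /existsP[a /existsP[b /and4P[ab bj pa bjB]]].
    have tia : (t i < a)%N := leq_trans tlt (mj _ pa).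
    have tiaB : [set t i; a] \in B.
      by rewrite setUC; apply: parT pa _; rewrite setUC.
    have := ncB _ _ _ _ tia ab bj; rewrite tiaB bjB => /(_ isT) /andP[_ ajB].
    by case/andP: pa; rewrite ajB.
  by rewrite mul1r subr_gt0 ltr_nat.
(* Since [t j < t i <= i < j], the point [i] itself separates [j] from [t j]; the sign of [j]
   compensates the negative difference. *)
- have -> : wrap j = true.
    apply/existsP; exists (t j); apply/existsP; exists i.
    by rewrite (leq_trans tgt) ?ij ?tj ?ijB //; apply: mi; apply: par_refl.
  by rewrite mulN1r oppr_gt0 subr_lt0 ltr_nat.
- by move: (subsetP Bpairs _ titj); rewrite tE pairs2 eqxx.
Qed.

End Realization.

(** * The matroids whose classes are the components of the graph *)

Section Closure.

Variables (n : nat) (D : {set {set 'I_n}}).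
Implicit Types (T : {set 'I_n}) (i j : 'I_n).

Local Notation bases T := (pcompl (Dplus_closure D T)).

Lemma mem_Gvertices T i : (i \in Gvertices D T) = (i \notin Tloops D) && (i \notin T).
Proof. by rewrite !inE negb_or. Qed.

Lemma Gedge_csym T : connect_sym (Gedge D T).
Proof.
by apply: sym_connect_sym => i j; rewrite /Gedge /= setUC eq_sym; apply/and4P/and4P => -[].
Qed.

Lemma Gvertices_closed T : closed (Gedge D T) (Gvertices D T).
Proof. by move=> i j /and4P[-> ->]. Qed.

(** A pair of [D] between two vertices is an edge, so connectivity alone accounts for both [D] and
    the closure. *)
Lemma mem2_closure_bases T i j :
  ([set i; j] \in bases T) =
  [&& i \in Gvertices D T, j \in Gvertices D T & ~~ connect (Gedge D T) i j].
Proof.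
rewrite mem2_pcompl; apply/andP/and3P => [[ij]|[iV jV cij]]; last first.
  have ij : i != j by apply: contraNneq cij => ->.
  split=> //; rewrite !inE !negb_or.
  have iT : i \notin T by move: iV; rewrite mem_Gvertices => /andP[].
  have jT : j \notin T by move: jV; rewrite mem_Gvertices => /andP[].
  apply/andP; split.
    apply/andP; split.
      apply: contra cij => ijD; apply: connect1; exact/and4P.
    apply/imset2P => -[k l kT _ E].
    have : k \in [set i; j] by rewrite E set21.
    by case/set2P=> kE; rewrite kE ?(negPf iT) ?(negPf jT) in kT.
  apply/imset2P => -[k l kV]; rewrite inE => /and3P[_ _ ckl] E.
  case/negP: cij; have : k \in [set i; j] by rewrite E set21.
  have : l \in [set i; j] by rewrite E set22.
  case/set2P=> lE; case/set2P=> kE; move: ckl; rewrite lE kE //.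
  - by move=> _; have := set22 i j; rewrite E lE kE => /set2P[] <-.
  - by rewrite Gedge_csym.
  - by move=> _; have := set21 i j; rewrite E lE kE => /set2P[] <-.
rewrite !in_setU !negb_or => /andP[/andP[ijD ijT] ijC].
have vert u v : u != v -> [set u; v] \notin D ->
    [set u; v] \notin [set [set i; j] | i in T, j in [set~ i]] ->
    u \in Gvertices D T.
  move=> uv uvD uvT; rewrite mem_Gvertices; apply/andP; split.
    by rewrite inE; apply/forallPn; exists v; rewrite negb_imply eq_sym uv.
  by apply: contra uvT => uT; apply/imset2P; exists u v; rewrite // !inE eq_sym.
have iV : i \in Gvertices D T by exact: vert ijD ijT.
have jV : j \in Gvertices D T.
  by apply: (@vert j i); rewrite 1?eq_sym 1?[[set j; i]]setUC.
split=> //; apply: contra ijC => cij; apply/imset2P; exists i j => //.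
by rewrite inE jV eq_sym ij.
Qed.

Lemma closure_bases_sub T : bases T \subset pcompl D.
Proof. by rewrite setDS // subsetU // subsetUl. Qed.

Lemma closure_bases_matroid T : bases T != set0 -> matroid (bases T).
Proof.
move=> B0; apply/matroidP; split=> //; first exact: pcompl_pairs.
move=> i j k l; rewrite !mem2_closure_bases => /and3P[-> -> cik] /and3P[-> _ _] /=.
by rewrite -negb_and; apply: contra cik => /andP[]; apply: connect_trans.
Qed.

Definition extra_loops (M : {set {set 'I_n}}) : {set 'I_n} :=
  [set i | (i \notin Tloops D) && [forall j, [set i; j] \notin M]].

(** An edge joins two non-loops of [M] that do not form a basis, so by exchange they are parallel,
    and connected points are parallel too. *)
Lemma matroid_sub_closure_bases (M : {set {set 'I_n}}) :
  matroid M -> M \subset pcompl D -> M \subset bases (extra_loops M).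
Proof.
move=> /matroidP[Mpairs M0 exch] MD.
have vert i j : [set i; j] \in M -> i \in Gvertices D (extra_loops M).
  move=> ijM; have := subsetP MD _ ijM; rewrite mem2_pcompl => /andP[ij ijD].
  have iL : i \notin Tloops D.
    by rewrite inE; apply/forallPn; exists j; rewrite negb_imply eq_sym ij.
  rewrite mem_Gvertices iL inE iL /=; apply/forallPn.
  by exists j; rewrite negbK.
apply/(pairs_subsetP _ Mpairs) => i j ijM; rewrite mem2_closure_bases.
rewrite (vert _ _ ijM) (vert j i) 1?setUC //=.
apply/negP => cij.
have clM : closed (Gedge D (extra_loops M)) [pred k | [set i; k] \notin M].
  apply: intro_closed; first exact: Gedge_csym.
  move=> k l /and4P[kV lV kl klD] /=; apply: contra => ilM.
  move: kV; rewrite mem_Gvertices [k \in extra_loops M]in_set => /andP[-> /forallPn[m]].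
  rewrite negbK => kmM.
  case/orP: (exch _ _ _ _ ilM kmM) => // klM.
  by have := subsetP MD _ klM; rewrite mem2_pcompl klD andbF.
have := closed_connect clM cij; rewrite !inE ijM /=.
suff -> : [set i; i] \notin M by [].
by apply: contraTN (eqxx i) => /(subsetP Mpairs); rewrite pairs2.
Qed.

Lemma extra_loops_sub (M : {set {set 'I_n}}) : extra_loops M \subset ~: Tloops D.
Proof. by apply/subsetP=> i; rewrite !inE => /andP[]. Qed.

(** One basis means at least two components, so every vertex has a partner outside its own
    component. *)
Lemma closure_basesP T : bases T != set0 ->
  forall i, i \in Gvertices D T -> exists j, [set i; j] \in bases T.
Proof.
case/(pairs_neq0P (pcompl_pairs _)) => a [b abB] i iV.
have := abB; rewrite mem2_closure_bases => /and3P[aV bV cab].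
have [cia|cia] := boolP (connect (Gedge D T) i a); last first.
  by exists a; rewrite mem2_closure_bases iV aV.
exists b; rewrite mem2_closure_bases iV bV /=; apply: contra cab.
by apply: connect_trans; rewrite Gedge_csym.
Qed.

Lemma closure_bases_loops T T' : T' \subset ~: Tloops D ->
  bases T != set0 -> bases T \subset bases T' -> T' \subset T.
Proof.
move=> T'L BT0 BTT'; apply/subsetP=> i iT'; apply: contraTT (iT') => iT.
have iV : i \in Gvertices D T.
  by rewrite mem_Gvertices iT andbT; have := subsetP T'L _ iT'; rewrite inE.
have [j /(subsetP BTT')] := closure_basesP BT0 iV.
by rewrite mem2_closure_bases mem_Gvertices => /and3P[/andP[]].
Qed.

Lemma Gedge_mono T T' : T' \subset T -> subrel (Gedge D T) (Gedge D T').
Proof.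
move=> T'T i j /and4P[]; rewrite !mem_Gvertices => /andP[iL iT] /andP[jL jT] ij ijD.
apply/and4P; split=> //; rewrite mem_Gvertices ?iL ?jL /=.
  by apply: contra iT; apply: (subsetP T'T).
by apply: contra jT; apply: (subsetP T'T).
Qed.

Lemma connect_Gedge_mono T T' : T' \subset T ->
  subrel (connect (Gedge D T)) (connect (Gedge D T')).
Proof. by move=> T'T; apply: connect_sub => i j /(Gedge_mono T'T); apply: connect1. Qed.

(** * Counting components when a point is restored *)

Lemma ncompE T : ncomp D T = #|root (Gedge D T) @: Gvertices D T|.
Proof.
rewrite /ncomp /n_comp_mem; apply: eq_card => i; rewrite inE /=.
have sym := Gedge_csym T.
apply/andP/imsetP => [[/eqP ri iV]|[k kV ->]]; first by exists i.
split; first exact: (roots_root sym).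
by rewrite -(closed_connect (@Gvertices_closed T) (connect_root _ k)).
Qed.

Lemma Gvertices_D1 T i : i \in T -> i \notin Tloops D ->
  Gvertices D (T :\ i) = i |: Gvertices D T.
Proof.
move=> iT iL; apply/setP=> j; rewrite in_setU1 !mem_Gvertices !inE.
by case: eqVneq => // ->; rewrite -[LHS]/(_ && true) andbT; rewrite inE in iL.
Qed.

(* The components of the graph with i restored are the images of the old ones,
   plus {i} when i is isolated; so their number drops iff two old ones merge. *)
Lemma ncomp_lt T i : i \in T -> i \notin Tloops D ->
  ncomp D (T :\ i) < ncomp D T <->
  exists x y, [/\ x \in Gvertices D T, y \in Gvertices D T,
    connect (Gedge D (T :\ i)) x y & ~~ connect (Gedge D T) x y].
Proof.
move=> iT iL; have sym := Gedge_csym T; have sym' := Gedge_csym (T :\ i).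
set e := Gedge D T in sym *; set e' := Gedge D (T :\ i) in sym' *.
have ee' : subrel (connect e) (connect e') by apply: connect_Gedge_mono (subD1set _ _).
have V'E := Gvertices_D1 iT iL.
set U := root e @: Gvertices D T.
(* [root e'] factors through [root e]: this is the map from old components to new ones, whose
   injectivity decides the count. *)
have UE : root e' @: Gvertices D T = root e' @: U.
  rewrite -imset_comp; apply: eq_imset => k /=.
  by apply/(rootP sym')/ee'; exact: connect_root.
rewrite !ncompE -/U V'E imsetU1 UE; split=> [lt|[x [y [xV yV cxy' cxy]]]].
  have : ~~ (#|root e' @: U| == #|U|).
    apply: contraL lt => /eqP <-; rewrite -leqNgt; apply: subset_leq_card.
    exact: subsetUr.
  move/imset_injP=> ninj.
  case: (pselect (exists x y, [/\ x \in Gvertices D T, y \in Gvertices D T,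
    connect e' x y & ~~ connect e x y])) => // nex.
  case: ninj => _ _ /imsetP[x xV ->] /imsetP[y yV ->] /(rootP sym') c'.
  apply/(rootP sym); apply: contrapT => /negP cxy; apply: nex; exists x, y; split=> //.
  apply: connect_trans (ee' _ _ (connect_root _ _)) (connect_trans c' _).
  by rewrite sym' ee' // connect_root.
(* Were [i] isolated, no edge would be new and [x], [y] would already be connected; so the component
   of [i] contains an old vertex. *)
have -> : root e' i |: root e' @: U = root e' @: U.
  apply/setUidPr; rewrite sub1set -UE.
  have [[w e'iw]|nw] := pselect (exists w, e' i w).
    apply/imsetP; exists w; last by apply/(rootP sym')/connect1.
    case/and4P: e'iw => _; rewrite V'E in_setU1 => /predU1P[->|//].
    by rewrite eqxx.
  case/negP: cxy; apply: connect_sub cxy' => u v uv; apply: connect1.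
  have ui : u != i by apply: contra_notN nw => /eqP <-; exists v.
  have vi : v != i.
    apply: contra_notN nw => /eqP <-; exists u.
    by case/and4P: uv => *; apply/and4P; split; rewrite 1?eq_sym // setUC.
  case/and4P: uv; rewrite V'E !in_setU1 (negPf ui) (negPf vi) /= => *.
  exact/and4P.
rewrite ltn_neqAle leq_imset_card andbT; apply/negP => /imset_injP inj.
case/negP: cxy; apply/(rootP sym)/inj; rewrite ?imset_f //.
apply/(rootP sym'); apply: connect_trans (connect_trans cxy' _).
  by rewrite sym' ee' // connect_root.
by rewrite ee' // connect_root.
Qed.

(** * Maximal matroids *)

Lemma Mat_closure_bases : Mat D = closure_bases D.
Proof.
apply/seteqP; split=> [M [[Mmat MD] Mmax]|_ [T [TTT BT0 ->]]] /=.
  pose T := extra_loops M.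
  have MT : M \subset bases T by exact: matroid_sub_closure_bases.
  have BT0 : bases T != set0.
    by have [_ M0 _] := Mmat; apply: contraNneq M0 => BT; rewrite -subset0 -BT.
  have ME : bases T = M.
    apply: Mmax MT; split; last exact: closure_bases_sub.
    exact: closure_bases_matroid.
  exists T; split=> //; rewrite inE extra_loops_sub /=.
  apply/orP; right; apply/forall_inP => i iT.
  have iL : i \notin Tloops D by have := subsetP (extra_loops_sub M) _ iT; rewrite inE.
  apply/(ncomp_lt iT iL).
  apply: contrapT => nex.
  (* If nothing merges, restoring [i] preserves every basis; maximality then equates two matroids
     that differ in the loop [i]. *)
  have sub : bases T \subset bases (T :\ i).
    apply/(pairs_subsetP _ (pcompl_pairs _)) => x y.
    rewrite !mem2_closure_bases => /and3P[xV yV cxy].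
    rewrite !(Gvertices_D1 iT iL) !in_setU1 xV yV !orbT /=.
    by apply: contra_notN nex => cxy'; exists x, y.
  have B'0 : bases (T :\ i) != set0.
    by apply: contraNneq BT0 => B'; rewrite -subset0 -B'.
  have B'E : bases (T :\ i) = M.
    apply: Mmax; last by rewrite -ME.
    by split; [exact: closure_bases_matroid | exact: closure_bases_sub].
  have : T \subset T :\ i.
    by apply: closure_bases_loops; rewrite ?extra_loops_sub // ME B'E.
  by move/subsetP => /(_ i iT); rewrite !inE eqxx.
move: TTT; rewrite inE => /andP[TL Tcond].
split=> [|M [Mmat MD] TM]; first split.
- exact: closure_bases_matroid.
- exact: closure_bases_sub.
pose T' := extra_loops M.
have MT' : M \subset bases T' by exact: matroid_sub_closure_bases.
have sub := subset_trans TM MT'.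
have T'T : T' \subset T by apply: closure_bases_loops sub; rewrite ?extra_loops_sub.
suff T'E : T' = T by apply/eqP; rewrite eqEsubset TM -{1}T'E MT'.
apply/eqP; rewrite eqEsubset T'T; apply/subsetP => i iT.
have iL : i \notin Tloops D by have := subsetP TL _ iT; rewrite inE.
case/orP: Tcond => [/eqP T0|/forall_inP/(_ i iT)]; first by rewrite T0 inE in iT.
case/(ncomp_lt iT iL) => x [y [xV yV cxy' cxy]]; apply: contraLR cxy' => iT'.
(* The pair merged by restoring [i] is a basis for [T], hence for [T']; but if [i] is not in [T'],
   the graph for [T'] contains the one for [T :\ i], which connects it. *)
have : [set x; y] \in bases T' by apply: (subsetP sub); rewrite mem2_closure_bases xV yV.
rewrite mem2_closure_bases => /and3P[_ _]; apply: contra.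
by apply: connect_Gedge_mono; rewrite subsetD1 T'T.
Qed.

End Closure.

(* An edge of the graph that jumped over b and d without either being joined to
   it would be a dependent pair in some Ds m whose class is crossed by b, d. *)
Lemma connect_separated n k (Ds : 'I_k -> {set {set 'I_n}}) (T : {set 'I_n})
    (D := \bigcup_(m < k) Ds m) (b d x y : 'I_n) :
  (forall m, noncrossing (pcompl (Ds m))) ->
  b \in Gvertices D T -> d \in Gvertices D T ->
  b < x -> x < d -> ~~ (b < y < d) -> connect (Gedge D T) x y ->
  connect (Gedge D T) x b || connect (Gedge D T) x d.
Proof.
move=> nc bV dV bx xd ybd cxy; apply: contraNT ybd; rewrite negb_or => /andP[cxb cxd].
set e := Gedge D T in cxy cxb cxd *.
have sym : connect_sym e by exact: Gedge_csym.
(* The part of the component of [x] strictly between [b] and [d]; no edge leaves it, so it contains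
   [y]. *)
pose S := [pred z | connect e x z && (b < z < d)].
suff clS : closed e S.
  by have := closed_connect clS cxy; rewrite !inE connect0 bx xd => /esym/andP[].
apply: intro_closed => // z w ezw /andP[cxz /andP[bz zd]].
have cxw : connect e x w := connect_trans cxz (connect1 ezw).
rewrite inE cxw /=.
have [zV wV zw /bigcupP[m _ zwm]] := and4P ezw.
have indep u v : u \in Gvertices D T -> v \in Gvertices D T ->
    connect e x u -> ~~ connect e x v -> [set u; v] \in pcompl (Ds m).
  move=> uV vV cxu cxv; have uv : u != v by apply: contraNneq cxv => <-.
  rewrite mem2_pcompl uv; apply: contra cxv => uvm.
  apply: connect_trans cxu (connect1 _); apply/and4P; split=> //.
  by apply/bigcupP; exists m.
have zbm := indep _ _ zV bV cxz cxb; have zdm := indep _ _ zV dV cxz cxd.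
have wbm := indep _ _ wV bV cxw cxb; have wdm := indep _ _ wV dV cxw cxd.
have zwF : ([set z; w] \in pcompl (Ds m)) = false by rewrite mem2_pcompl zwm andbF.
have [bw|wb|/val_inj wb] := ltngtP b w; last by rewrite wb cxw in cxb.
  have [wd|dw|/val_inj wd] := ltngtP w d => //; last by rewrite -wd cxw in cxd.
  have := nc m _ _ _ _ bz zd dw.
  by rewrite [[set b; z]]setUC zbm [[set d; w]]setUC wdm zwF andbF => /(_ isT).
have := nc m _ _ _ _ wb bz zd.
by rewrite wdm [[set b; z]]setUC zbm orbT [[set w; z]]setUC zwF => /(_ isT).
Qed.

(** If [a] and [c] are connected, going from [c] to [a] leaves the interval between [b] and [d], so
    [b] or [d] joins their component, which destroys a pair in each alternative of the hypothesis.
    The case of [b] and [d] is symmetric. *)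
Lemma closure_bases_noncrossing n k (Ds : 'I_k -> {set {set 'I_n}}) (T : {set 'I_n})
    (D := \bigcup_(m < k) Ds m) :
  (forall m, noncrossing (pcompl (Ds m))) ->
  noncrossing (pcompl (Dplus_closure D T)).
Proof.
move=> nc a b c d ab bc cd; rewrite !mem2_closure_bases.
have sym := Gedge_csym D T; set e := Gedge D T in sym *.
set V := Gvertices D T => crossed.
have [aV bV cV dV] : [/\ a \in V, b \in V, c \in V & d \in V].
  by case/orP: crossed => /andP[/and3P[? ? _] /and3P[? ? _]]; split.
move: crossed; rewrite aV bV cV dV /= => crossed; rewrite -negb_or.
apply: contraL crossed; rewrite negb_or !negb_and !negbK => /orP[cac|cbd].
  have cca : connect e c a by rewrite sym.
  have acE := same_connect sym cac.
  have : connect e c b || connect e c d.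
    by apply: (connect_separated nc bV dV bc cd _ cca); rewrite [b < a]ltnNge ltnW.
  by rewrite -!acE [connect e b c]sym -acE => /orP[] ->; rewrite ?orbT.
have bdE := same_connect sym cbd.
have : connect e b a || connect e b c.
  by apply: (connect_separated nc aV cV ab bc _ cbd); rewrite [d < c]ltnNge (ltnW cd) andbF.
rewrite [connect e a b]sym [connect e c d]sym [connect e a d]sym -!bdE.
by case/orP=> ->; rewrite ?orbT.
Qed.

Theorem proposition4p7 (R : realType) (n k : nat) (hn : (2 <= n)%N) (hk : (1 <= k)%N)
    (Ds : 'I_k -> {set {set 'I_n}})
    (hsub : forall i : 'I_k, Ds i \subset pairs n)
    (hpos : forall i : 'I_k, positroid R (pcompl (Ds i))) :
  let D : {set {set 'I_n}} := \bigcup_(i < k) Ds i in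
  [/\ max_boundary_positroids R Ds = MPos R D,
      MPos R D = Mat D
    & Mat D = closure_bases D].
Proof.
move=> D; split; last exact: Mat_closure_bases.
  congr (inclusion_maximal _); apply/funext => P; apply/propext.
  split=> -[Ppos PD]; split=> //.
    have [Ppairs _ _] := Ppos; apply/(pairs_subsetP _ Ppairs) => i j ijP.
    rewrite mem2_pcompl -pairs2 (subsetP Ppairs) //=.
    apply/bigcupP => -[m _ ijm].
    by have := subsetP (PD m) _ ijP; rewrite mem2_pcompl ijm andbF.
  by move=> m; apply: subset_trans PD (setDS _ (bigcup_sup m _)).
have nc m : noncrossing (pcompl (Ds m)) by have [] := positroid_noncrossing (hpos m).
have pos_mat P : positroid R P -> matroid P by case/positroid_noncrossing.
(* Positroids are cofinal among the matroids avoiding [D], so both families have the same maximal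
   elements. *)
have sup M : matroid M -> M \subset pcompl D -> exists P,
    [/\ positroid R P, P \subset pcompl D & M \subset P].
  move=> Mmat MD; have MT := matroid_sub_closure_bases Mmat MD.
  exists (pcompl (Dplus_closure D (extra_loops D M))); split=> //.
    apply: noncrossing_positroid; last exact: closure_bases_noncrossing.
    apply: closure_bases_matroid; have [_ M0 _] := Mmat.
    by apply: contraNneq M0 => BT; rewrite -subset0 -BT.
  exact: closure_bases_sub.
apply/seteqP; split=> [P [[Ppos PD] Pmax]|M [[Mmat MD] Mmax]] /=.
  split=> [|M [Mmat MD] PM]; first by split=> //; exact: pos_mat.
  have [Q [Qpos QD MQ]] := sup M Mmat MD.
  have QP : Q = P by apply: Pmax; [|exact: subset_trans PM MQ].
  by apply/eqP; rewrite eqEsubset PM -QP MQ.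
have [P [Ppos PD MP]] := sup M Mmat MD.
have PM : P = M by apply: Mmax => //; split=> //; exact: pos_mat.
split=> [|Q [Qpos QD]]; first by rewrite -PM.
by apply: Mmax; split=> //; exact: pos_mat.
Qed.
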